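(* Let $q\in\,]0,1[$. For each integer $n\geq1$ let $\sigma$ be a random permutation in $\mathfrak{S}_n$ such that the probability of picking $\sigma$ is proportional to $q^{\mathrm{imaj}(\sigma)}$, and let $\ell(\sigma)$ be the length of the longest increasing subsequence of $\sigma$. Then, as $n\to\infty$, $\ell(\sigma)$ is equivalent in probability to $n(1-q)$, i.e. $\ell(\sigma)/(n(1-q))\to1$ in probability. Moreover, the rescaled deviation $$\frac{\ell(\sigma)-n(1-q)}{\sqrt{n}}$$ converges in law towards a centered normal law of variance $q(1-q)$.
   Context: For $\sigma\in\mathfrak{S}_n$, $\mathrm{imaj}(\sigma)$ (called the major index) is the sum of the integers $i$ between $1$ and $n-1$ such that $\sigma(i)>\sigma(i+1)$. An increasing subsequence of $\sigma$ is a sequence $i_1<\cdots<i_k$ with $\sigma(i_1)<\cdots<\sigma(i_k)$; its length is $k$. *)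

(* Defs.v *)
From HB Require Import structures.
From mathcomp Require Import all_boot all_order all_algebra all_fingroup.
From mathcomp Require Import all_classical all_reals all_analysis.

Set Implicit Arguments.
Unset Strict Implicit.
Unset Printing Implicit Defensive.

Import Order.TTheory GRing.Theory Num.Theory.
Import numFieldNormedType.Exports.

Local Open Scope classical_set_scope.
Local Open Scope ring_scope.

Section permutation_statistics.
Variable n : nat.
Implicit Types s : 'S_n.

(* Positions are numbered from 0 here, so a descent at [i : 'I_n] is a descent
   at [i.+1] in the usual numbering.  [ordS] is the cyclic successor; the guard
   [i.+1 < n] excludes the wrap-around. *)
Definition imaj s : nat :=
  (\sum_(i < n | (i.+1 < n) && (s (ordS i) < s i)) i.+1)%N.

(* A subsequence i_1 < ... < i_k is encoded by its set of positions. *)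
Definition increasing_on s (I : {set 'I_n}) : bool :=
  [forall i in I, forall j in I, (i < j)%N ==> (s i < s j)%N].

Definition lis s : nat := (\max_(I : {set 'I_n} | increasing_on s I) #|I|)%N.

End permutation_statistics.

HB.instance Definition _ (T : finType) := isPointed.Build (perm_type T) 1%g.

HB.instance Definition _ (T : finType) :=
  @isMeasurable.Build default_measure_display (perm_type T) discrete_measurable
    discrete_measurable0 discrete_measurableC discrete_measurableU.

Section discrete_random_variable.
Context {T : finType} {R : realType}.
Variable f : {perm T} -> R.

(* Every function on permutations is measurable (discrete sigma-algebra); this
   wrapper carries the corresponding random variable structure. *)
Definition perm_rv : {perm T} -> R := f.

Lemma measurable_perm_rv : measurable_fun [set: {perm T}] perm_rv.
Proof. by []. Qed.

HB.instance Definition _ :=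
  isMeasurableFun.Build _ _ {perm T} R perm_rv measurable_perm_rv.

End discrete_random_variable.

Section imaj_probability.
Context {R : realType}.
Variable q : R.

Definition imaj_pmf n (s : 'S_n) : R :=
  q ^+ imaj s / \sum_(t : 'S_n) q ^+ imaj t.

Hypothesis q0 : 0 < q.

Lemma imaj_partition_gt0 n : 0 < \sum_(t : 'S_n) q ^+ imaj t.
Proof.
rewrite (bigD1 (1%g : 'S_n))//= ltr_pwDl ?exprn_gt0//.
by apply: sumr_ge0 => t _; rewrite exprn_ge0// ltW.
Qed.

Lemma imaj_pmf_ge0 n (s : 'S_n) : 0 <= imaj_pmf s.
Proof.
by rewrite divr_ge0 ?exprn_ge0 ?(ltW (imaj_partition_gt0 _))// ltW.
Qed.

Lemma sum_imaj_pmf n : \sum_(s : 'S_n) imaj_pmf s = 1.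
Proof. by rewrite -mulr_suml divff// gt_eqF// imaj_partition_gt0. Qed.

(* The unused proof [q_gt0] lets the probability instance below be inferred
   from the term. *)
Definition imaj_prob (q_gt0 : 0 < q) (n : nat) (A : set 'S_n) : \bar R :=
  (\sum_(s : 'S_n) (imaj_pmf s)%:E * \d_s A)%E.
Arguments imaj_prob q_gt0 n A : clear implicits.

Variable n : nat.

Let imaj_prob_msum : imaj_prob q0 n = msum (fun k =>
  mscale (NngNum (imaj_pmf_ge0 (nth (1%g : 'S_n) (enum 'S_n) k)))
         (\d_(nth (1%g : 'S_n) (enum 'S_n) k))) (size (enum 'S_n)).
Proof.
apply/funext => A; rewrite /imaj_prob /msum /mscale/= -big_enum/=.
rewrite (big_nth 1%g) big_mkord; apply: congr_big => //.
Qed.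

Let imaj_prob0 : imaj_prob q0 n set0 = 0%E.
Proof. by rewrite imaj_prob_msum measure0. Qed.

Let imaj_prob_ge0 A : (0 <= imaj_prob q0 n A)%E.
Proof. by rewrite imaj_prob_msum measure_ge0. Qed.

Let imaj_prob_sigma_additive : semi_sigma_additive (imaj_prob q0 n).
Proof. by rewrite imaj_prob_msum; exact: measure_semi_sigma_additive. Qed.

HB.instance Definition _ := isMeasure.Build _ _ _ (imaj_prob q0 n)
  imaj_prob0 imaj_prob_ge0 imaj_prob_sigma_additive.

Let imaj_prob_setT : imaj_prob q0 n [set: _] = 1%E.
Proof.
rewrite /imaj_prob; under eq_bigr do rewrite diracT mule1.
by rewrite sumEFin sum_imaj_pmf.
Qed.

HB.instance Definition _ := Measure_isProbability.Build _ _ _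
  (imaj_prob q0 n) imaj_prob_setT.

Lemma imaj_prob_set1 (s : 'S_n) : imaj_prob q0 n [set s] = (imaj_pmf s)%:E.
Proof.
rewrite /imaj_prob (bigD1 s)//= big1 ?adde0 => [|t ts].
  by rewrite diracE mem_set// mule1.
by rewrite diracE memNset ?mule0//= => /eqP; rewrite (negbTE ts).
Qed.

End imaj_probability.
Arguments imaj_prob {R q} q_gt0 n A.

Section modes_of_convergence.
Context {R : realType} {d : measure_display} {T : nat -> measurableType d}.
Variable P : forall n, probability (T n) R.
Variable X : forall n, {RV (P n) >-> R}.

Definition cvg_in_prob_to_cst (c : R) : Prop :=
  forall e : R, 0 < e ->
    P n [set w | e < `|X n w - c|] @[n --> \oo] --> 0%E.

(* [measurableTypeR R] is [R] with its Borel sets, the type on which the library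
   defines [normal_prob m s]; [s] there is the standard deviation. *)
Definition cvg_in_law (mu : probability (measurableTypeR R) R) : Prop :=
  forall f : R -> R, continuous f -> bounded_fun f ->
    ('E_(P n)[f \o X n] @[n --> \oo] --> \int[mu]_y (f y)%:E)%E.

End modes_of_convergence.

(* Main.v *)
Require Import Defs.
From HB Require Import structures.
From mathcomp Require Import all_boot all_order all_algebra all_fingroup.
From mathcomp Require Import all_classical all_reals all_analysis.
From mathcomp Require Import measurable_realfun ring lra zify.

(** Sort a word of [n] letters stably in decreasing order.  If [s] is the sorting
    permutation of the word [w], then [w \o s] is weakly decreasing and drops at every
    descent of [s]; subtracting the number of descents still to come is a bijection
    onto all weakly decreasing words, and it lowers the sum of the letters by
    [imaj s].  Consequently, when the letters are independent and geometric,
    P(a) = (1 - q) q^a, the sorting permutation has a probability proportional to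
    [q ^+ imaj s] (lemma [cvg_sorted_mass], where the alphabet is first truncated to [N]
    letters).  So [lis s] may be studied as the length of the longest weakly
    decreasing subword of a word of independent geometric letters.

    The zeros of the word form such a subword, and their number is binomial with
    parameters [n] and [1 - q].  Nothing much longer exists: [0] is more likely than any
    other letter by a factor at least 1/q, even when all letters from some [M] on are
    merged, so that moving from left to right a subword loses on average by choosing a
    nonzero letter instead of [0].  A weakly decreasing choice of letters is given by
    [M] thresholds; an exponential moment bound for each choice and a union bound
    over the (n + 1)^M choices show that the gap between [lis s] and the number of
    zeros reaches [k] with probability at most q^k (n + 1)^M.  With [k] of order the
    square root of [n] this is negligible, and [lis_mean_le] states it in the form of a
    comparison of means.

    What remains is the binomial law.  Its variance, with Chebyshev's inequality,
    gives the convergence in probability.  Its central limit theorem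
    ([binomial_clt]) is proved by Stein's method: [stein_solution] solves
    v f'(x) - x f(x) = h(x) - E h(Z) for a normal Z of variance v, with [f'] continuous and
    bounded; [binomial_stein] transforms the mean of x f(x) into that of a difference
    quotient of f, and [oscillation_le] compares the latter with f'. *)

Set Implicit Arguments.
Unset Strict Implicit.
Unset Printing Implicit Defensive.

Import Order.TTheory GRing.Theory Num.Theory.
Import numFieldNormedType.Exports.

Local Open Scope ring_scope.

(** * Stable sorting of words *)

Lemma ord_chain n (r : 'I_n -> 'I_n -> Prop) :
  (forall j i k, r i j -> r j k -> r i k) ->
  (forall i : 'I_n, (i.+1 < n)%N -> r i (ordS i)) ->
  forall i j : 'I_n, (i < j)%N -> r i j.
Proof.
move=> r_trans r_next i j ij.
have [m] : exists m, (j = i + m.+1 :> nat)%N by exists (j - i.+1)%N; lia.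
elim: m j {ij} => [|m IH] j ji.
  have lt_n : (i.+1 < n)%N by have := ltn_ord j; lia.
  suff -> : j = ordS i by exact: r_next.
  by apply/val_inj; rewrite /= modn_small// ji addn1.
have lt_n : (i + m.+1 < n)%N by have := ltn_ord j; lia.
apply: (r_trans (Ordinal lt_n)); first exact: IH.
suff -> : j = ordS (Ordinal lt_n) by apply: r_next => /=; have := ltn_ord j; lia.
by apply/val_inj; rewrite /= modn_small; have := ltn_ord j; lia.
Qed.

Section sorting.
Variable n : nat.
Implicit Types (s t : 'S_n) (w : 'I_n -> nat).

(** The order in which a stable sort by decreasing letters lists the positions:
    larger letters first, and equal letters from left to right. *)
Definition precedes w (x y : 'I_n) : bool :=
  (w y < w x)%N || (w y == w x) && (x < y)%N.

Definition sorts s w : bool :=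
  [forall i : 'I_n, forall j : 'I_n, (i < j)%N ==> precedes w (s i) (s j)].

Lemma sortsP s w :
  reflect (forall i j : 'I_n, (i < j)%N -> precedes w (s i) (s j)) (sorts s w).
Proof.
apply: (iffP forallP) => [h i j ij|h i].
  by have /forallP/(_ j)/implyP := h i; apply.
by apply/forallP => j; apply/implyP; exact: h.
Qed.

Lemma precedes_trans w y x z : precedes w x y -> precedes w y z -> precedes w x z.
Proof. rewrite /precedes; lia. Qed.

Lemma precedes_irr w x : precedes w x x = false.
Proof. by rewrite /precedes; lia. Qed.

Lemma precedes_total w x y : x != y -> precedes w x y || precedes w y x.
Proof. by rewrite /precedes -val_eqE /=; lia. Qed.

Let rank w (x : 'I_n) : nat := #|[set y | precedes w y x]|.

Let rank_mono w x y : precedes w x y -> (rank w x < rank w y)%N.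
Proof.
move=> xy; apply: proper_card; apply/properP; split.
  by apply/fintype.subsetP => z; rewrite !inE => /precedes_trans; exact.
by exists x; rewrite !inE ?precedes_irr.
Qed.

Let rank_sorts s w : sorts s w -> forall i, rank w (s i) = i.
Proof.
move=> /sortsP sw i; rewrite /rank.
rewrite (_ : [set y | _] = [set s k | k in [set k : 'I_n | (k < i)%N]]).
  rewrite card_imset; last exact: perm_inj.
  rewrite cardsE -sum1_card (big_ord_narrow (ltnW (ltn_ord i)))/=.
  by rewrite sum1_card card_ord.
apply/setP => y; rewrite inE; apply/idP/imsetP => [yi|[k]].
  exists (s^-1 y)%g; rewrite ?permKV// inE ltnNge leq_eqVlt.
  apply/negP => /orP[/eqP/val_inj eqi|/sw]; rewrite ?permKV.
    by move: yi; rewrite eqi permKV precedes_irr.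
  by move=> /(precedes_trans yi); rewrite precedes_irr.
by rewrite inE => ki ->; exact: sw.
Qed.

(** A sorting permutation [s] puts at place [i] the position preceded by exactly
    [i] others, so that the word determines [s]. *)
Lemma sorts_uniq s t w : sorts s w -> sorts t w -> s = t.
Proof.
move=> sw tw; apply/permP => i; apply: (can_inj (permK t^-1)%g); rewrite permK.
apply/val_inj.
by rewrite /= -(rank_sorts tw (t^-1 (s i))%g) permKV (rank_sorts sw).
Qed.

(** [precedes] is a strict total order, so counting predecessors is injective and
    bounded by [n]; the inverse of the resulting permutation sorts the word. *)
Lemma sorts_exists w : exists s, sorts s w.
Proof.
have rank_lt x : (rank w x < n)%N.
  rewrite -[ltnRHS]card_ord -cardsT; apply: proper_card.
  by apply/properP; split; [exact: finset.subsetT|exists x; rewrite !inE ?precedes_irr].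
pose r x := Ordinal (rank_lt x).
have r_inj : injective r.
  move=> x y [] /eqP; apply: contraTeq => /(precedes_total w).
  by case/orP => /rank_mono; lia.
pose s : 'S_n := ((perm r_inj)^-1)%g.
have rankE i : rank w (s i) = i by rewrite -[in RHS](permKV (perm r_inj) i) permE.
exists s; apply/sortsP => i j; rewrite -{1}(rankE i) -{1}(rankE j).
move: (s i) (s j) => x y ij.
have xy : x != y by apply: contraTneq ij => ->; rewrite ltnn.
by case/orP: (precedes_total w xy) => // /rank_mono; lia.
Qed.

End sorting.

(** * Sorted words and the major index *)

Section descents.
Variable n : nat.
Implicit Types (s : 'S_n) (i j : 'I_n) (w b : 'I_n -> nat).

Definition descent s i : bool := (i.+1 < n)%N && (s (ordS i) < s i)%N.

(** The least weakly decreasing word that drops strictly at each descent of [s].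
    Its letters add up to [imaj s], because the descent at [j] contributes [1] to
    each of the [j.+1] first letters. *)
Definition descents_from s i : nat := (\sum_(j < n | (i <= j)%N) descent s j)%N.

Lemma sum_descents_from s : (\sum_(i < n) descents_from s i)%N = imaj s.
Proof.
rewrite /descents_from /imaj.
rewrite (exchange_big_dep xpredT)//= [RHS]big_mkcond/=; apply: eq_bigr => j _.
rewrite -/(descent s j); case: (descent s j); last by rewrite big1.
rewrite (eq_bigl (fun i : 'I_n => (i < j.+1)%N)) => [|i]; last by rewrite ltnS.
by rewrite (big_ord_narrow (ltn_ord j))/= sum1_card card_ord.
Qed.

Lemma descents_from_le s i : (descents_from s i <= n)%N.
Proof.
rewrite -[leqRHS]card_ord -sum1_card /descents_from big_mkcond.
by apply: leq_sum => j _; case: ifP => // _; case: descent.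
Qed.

Lemma descents_fromS s i : (i.+1 < n)%N ->
  descents_from s i = (descent s i + descents_from s (ordS i))%N.
Proof.
move=> lt_n; rewrite /descents_from (bigD1 i)//=; congr addn.
apply: eq_bigl => j; rewrite modn_small//.
by rewrite -val_eqE /=; lia.
Qed.

Lemma descents_from_last s i : i.+1 = n -> descents_from s i = 0%N.
Proof.
move=> lastn; rewrite /descents_from big1// => j ij.
by rewrite /descent; have := ltn_ord j; case: ltnP => //=; lia.
Qed.

Definition decreasing b : bool :=
  [forall i : 'I_n, forall j : 'I_n, (i <= j)%N ==> (b j <= b i)%N].

Lemma decreasingP b :
  reflect (forall i j, (i <= j)%N -> (b j <= b i)%N) (decreasing b).
Proof.
apply: (iffP forallP) => [h i j ij|h i].
  by have /forallP/(_ j)/implyP := h i; apply.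
by apply/forallP => j; apply/implyP; exact: h.
Qed.

(** When [s] sorts [w], the word [w \o s] decreases weakly and must drop strictly at
    every descent of [s], because equal letters are listed from left to right.
    Hence [w \o s] minus [descents_from s] is still weakly decreasing. *)
Lemma sorts_descents s w : sorts s w -> forall i j, (i <= j)%N ->
  (w (s j) + descents_from s i <= w (s i) + descents_from s j)%N.
Proof.
move=> /sortsP sw i j; rewrite leq_eqVlt => /orP[/eqP/val_inj->//|].
apply: (@ord_chain n (fun i j =>
  (w (s j) + descents_from s i <= w (s i) + descents_from s j)%N)) => {i j}.
  by move=> j i k; lia.
move=> i lt_n; rewrite (descents_fromS s lt_n).
have iS : (i < ordS i)%N by rewrite /= modn_small.
have := sw _ _ iS; rewrite /precedes /descent lt_n /=; lia.
Qed.

Lemma sorts_descents_ge s w : sorts s w -> forall i, (descents_from s i <= w (s i))%N.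
Proof.
move=> sw i; have lt_n : (n.-1 < n)%N by have := ltn_ord i; lia.
have := sorts_descents sw (i := i) (j := Ordinal lt_n).
rewrite (@descents_from_last s (Ordinal lt_n))/=; have := ltn_ord i; lia.
Qed.

(** The converse of [sorts_descents]: together they make the words sorted by [s]
    correspond to the weakly decreasing words, by subtraction of [descents_from s]. *)
Lemma decreasing_sorts s b : decreasing b ->
  sorts s (fun x => b (s^-1 x)%g + descents_from s (s^-1 x)%g)%N.
Proof.
move=> /decreasingP db; apply/sortsP.
apply: ord_chain => [j i k|i lt_n]; first exact: precedes_trans.
have lt_ne : s i != s (ordS i) by rewrite (inj_eq perm_inj) -val_eqE /= modn_small//; lia.
have iS : (i <= ordS i)%N by rewrite /= modn_small.
have := db _ _ iS; move: lt_ne.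
rewrite /precedes !permK (descents_fromS s lt_n) /descent lt_n /= -val_eqE /=; lia.
Qed.

End descents.

(** * Increasing subsequences as weakly decreasing subwords *)

Section thresholds.
Variables (n N : nat).
Implicit Types (s : 'S_n) (w : {ffun 'I_n -> 'I_N}).

Definition zeros w : nat := (\sum_(x < n) (w x == 0 :> nat))%N.

(** Every weakly decreasing function from ['I_n] to [0 .. M] has this form; there are
    only polynomially many threshold families [t], which makes a union bound over
    them affordable. *)
Definition staircase M (t : {ffun 'I_M -> 'I_n.+1}) (x : 'I_n) : nat :=
  (\sum_(v < M) (x < t v))%N.

Definition matches M (t : {ffun 'I_M -> 'I_n.+1}) w : nat :=
  (\sum_(x < n) (minn (w x) M == staircase t x))%N.

Lemma card_sum_bool (T : finType) (P : pred T) : #|[set x | P x]| = (\sum_x P x)%N.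
Proof. by rewrite -sum1_card big_mkcond; apply: eq_bigr => x _; rewrite inE; case: (P x). Qed.

(** The letters equal to [0] are listed from left to right at the end of the stable
    sort, and so they form an increasing subsequence. *)
Lemma zeros_le_lis s w : sorts s (fun x => w x) -> (zeros w <= lis s)%N.
Proof.
move=> /sortsP sw; rewrite /zeros -card_sum_bool -(card_preimset _ (@perm_inj _ s)).
apply: (@leq_bigmax_cond _ _ (fun I : {set 'I_n} => #|I|)).
apply/forall_inP => i /[!inE] /eqP wi; apply/forall_inP => j /[!inE] /eqP wj.
by apply/implyP => /sw; rewrite /precedes wi wj.
Qed.

Lemma zeros_le w : (zeros w <= n)%N.
Proof.
by rewrite /zeros -card_sum_bool -[leqRHS]card_ord; exact: max_card.
Qed.

Lemma lis_le s : (lis s <= n)%N.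
Proof. by apply/bigmax_leqP => I _; rewrite -[leqRHS]card_ord; exact: max_card. Qed.

(** An increasing subsequence of [s] selects positions along which [w], hence also
    [minn w M], decreases weakly.  The threshold for [v] is the last selected
    position whose letter exceeds [v]; the staircase then agrees with [minn w M] on all
    selected positions. *)
Lemma lis_le_matches M s w : sorts s (fun x => w x) ->
  exists t : {ffun 'I_M -> 'I_n.+1}, (lis s <= matches t w)%N.
Proof.
move=> /sortsP sw.
have [I incI lisE] : {I : {set 'I_n} | increasing_on s I & lis s = #|I|}.
  apply: (@eq_bigmax_cond _ _ (fun I : {set 'I_n} => #|I|)); apply/card_gt0P.
  by exists finset.set0; apply/forall_inP => i; rewrite inE.
pose J := [set s i | i in I].
pose last_above v := (\max_(y in J | v < w y) y.+1)%N.
have last_above_lt v : (last_above v < n.+1)%N by rewrite ltnS; apply/bigmax_leqP.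
exists [ffun v : 'I_M => Ordinal (last_above_lt v)].
rewrite lisE -(card_imset _ (@perm_inj _ s)) -/J /matches -card_sum_bool.
apply: subset_leq_card; apply/fintype.subsetP => x xJ; rewrite inE /staircase.
have above_last (v : 'I_M) :
    (x < [ffun v : 'I_M => Ordinal (last_above_lt v)] v)%N = (v < w x)%N.
  rewrite ffunE /=; apply/idP/idP => [|vx]; last first.
    by apply: (@leq_bigmax_cond _ _ (fun y : 'I_n => y.+1)); rewrite xJ.
  apply: contraTT; rewrite -!leqNgt => xv; apply/bigmax_leqP => y /andP[yJ vy].
  rewrite ltnNge; apply/negP => xy; move: vy; rewrite ltnNge => /negP; apply.
  apply: leq_trans xv.
  case/imsetP: xJ xy => i iI -> {x}; case/imsetP: yJ => j jI -> {y}.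
  rewrite leq_eqVlt => /orP[/eqP/val_inj/perm_inj->//|ij].
  have lt_ij : (i < j)%N.
    rewrite ltnNge leq_eqVlt; apply/negP => /orP[/eqP/val_inj ji|ji].
      by move: ij; rewrite ji ltnn.
    have /forall_inP/(_ _ jI)/forall_inP/(_ _ iI)/implyP/(_ ji) := incI.
    by rewrite ltnNge ltnW.
  by have := sw _ _ lt_ij; rewrite /precedes; lia.
rewrite (eq_bigr (fun v : 'I_M => ((v < w x)%N : nat))) => [|v _]; last first.
  by rewrite above_last.
elim: M {last_above last_above_lt above_last} => [|M IH]; first by rewrite big_ord0 minn0.
by rewrite big_ord_recr /=; move/eqP: IH => <-; lia.
Qed.

End thresholds.

(** * Geometric weights on words and the law of the sorting permutation *)

Local Open Scope classical_set_scope.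

Lemma cvgn_sum (K : numFieldType) (V : pseudoMetricNormedZmodType K) (I : Type)
    (r : seq I) (u : I -> nat -> V) (l : I -> V) :
  (forall i, u i N @[N --> \oo] --> l i) ->
  \sum_(i <- r) u i N @[N --> \oo] --> \sum_(i <- r) l i.
Proof.
move=> ul; elim: r => [|i r IH].
  by rewrite big_nil; under eq_fun do rewrite big_nil; exact: cvg_cst.
by rewrite big_cons; under eq_fun do rewrite big_cons; exact: cvgD.
Qed.

Lemma ler_sum_inj (R : numDomainType) (A B : finType) (P : pred A) (Q : pred B) (h : A -> B)
    (F : A -> R) (G : B -> R) :
  {in P &, injective h} -> (forall a, P a -> Q (h a)) ->
  (forall a, P a -> F a = G (h a)) -> (forall b, 0 <= G b) ->
  \sum_(a | P a) F a <= \sum_(b | Q b) G b.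
Proof.
move=> hinj hPQ FG G0; rewrite (eq_bigr _ FG).
rewrite -(big_imset G hinj) [leRHS](bigID (mem (h @: P)))/=.
rewrite [X in _ <= X + _](eq_bigl (mem (h @: P))) ?lerDl ?sumr_ge0// => b.
by apply: andb_idl => /imsetP[a Pa ->]; exact: hPQ.
Qed.

Section weights.
Context {R : realType}.
Variable q : R.
Hypotheses (q0 : 0 < q) (q1 : q < 1).

(** Up to normalisation, the law of [n] independent letters with a geometric law
    truncated to [0 .. N.-1].  The truncation keeps every sum finite; it is removed
    by letting [N] tend to infinity. *)
Definition weight n N (w : {ffun 'I_n -> 'I_N}) : R := q ^+ (\sum_(x < n) w x)%N.

Definition letter_sum N : R := \sum_(a < N) q ^+ a.

Definition sorted_mass n N (s : 'S_n) : R :=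
  \sum_(w : {ffun 'I_n -> 'I_N} | sorts s (fun x => w x)) weight w.

Definition decreasing_mass n N : R :=
  \sum_(b : {ffun 'I_n -> 'I_N} | decreasing (fun x => b x)) weight b.

Lemma weight_ge0 n N (w : {ffun 'I_n -> 'I_N}) : 0 <= weight w.
Proof. exact/exprn_ge0/ltW. Qed.

Lemma weight_prod n N (w : {ffun 'I_n -> 'I_N}) : weight w = \prod_(x < n) q ^+ w x.
Proof. by rewrite /weight expr_sum. Qed.

Lemma sum_weight n N : \sum_(w : {ffun 'I_n -> 'I_N}) weight w = letter_sum N ^+ n.
Proof.
under eq_bigr do rewrite weight_prod.
by rewrite -(bigA_distr_bigA (fun (_ : 'I_n) (a : 'I_N) => q ^+ a)) prodr_const card_ord.
Qed.

Lemma sum_sorts n N (G : {ffun 'I_n -> 'I_N} -> R) :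
  \sum_(s : 'S_n) \sum_(w : {ffun 'I_n -> 'I_N} | sorts s (fun x => w x)) G w =
  \sum_w G w.
Proof.
rewrite (exchange_big_dep xpredT)//=; apply: eq_bigr => w _.
have [s sw] := sorts_exists (fun x => w x).
rewrite (big_pred1 s)// => t; apply/idP/eqP => [tw|->//]; exact: sorts_uniq tw sw.
Qed.

Lemma decreasing_mass_mono n : nondecreasing_seq (decreasing_mass n).
Proof.
apply/nondecreasing_seqP => N.
pose h (b : {ffun 'I_n -> 'I_N}) := [ffun x => widen_ord (leqnSn N) (b x)].
apply: (@ler_sum_inj _ _ _ _ _ h) => [b c _ _ /ffunP bc|b /decreasingP db|b _|b].
- by apply/ffunP => x; have := bc x; rewrite !ffunE => -[/val_inj].
- by apply/decreasingP => i j /db; rewrite !ffunE.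
- by congr (_ ^+ _); apply: eq_bigr => x _; rewrite ffunE.
- exact: weight_ge0.
Qed.

(** Subtracting [descents_from s] injects the words sorted by [s] into the decreasing
    words and divides the weight by [q ^+ imaj s]. *)
Lemma sorted_mass_le n N (s : 'S_n) :
  sorted_mass N s <= q ^+ imaj s * decreasing_mass n N.
Proof.
rewrite /decreasing_mass mulr_sumr.
have sub_lt (w : {ffun 'I_n -> 'I_N}) i : (w (s i) - descents_from s i < N)%N.
  exact: leq_ltn_trans (leq_subr _ _) (ltn_ord _).
pose h (w : {ffun 'I_n -> 'I_N}) := [ffun i => Ordinal (sub_lt w i)].
have hE (w : {ffun 'I_n -> 'I_N}) : sorts s (fun x => w x) ->
    forall i, w (s i) = (h w i + descents_from s i)%N :> nat.
  by move=> /sorts_descents_ge sw i; rewrite ffunE /= subnK.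
apply: (@ler_sum_inj _ _ _ _ _ h) => [w v sw sv hwv|w sw|w sw|b].
- apply/ffunP => x; apply/val_inj; rewrite /= -(permKV s x) hE// hE// hwv//.
- apply/decreasingP => i j /(sorts_descents sw).
  by rewrite (hE _ sw i) (hE _ sw j) addnAC !leq_add2r.
- rewrite /weight -exprD -sum_descents_from -big_split /=.
  by rewrite (reindex_inj (@perm_inj _ s))/=; congr (_ ^+ _); apply: eq_bigr => i _;
    rewrite (hE _ sw) addnC.
- by rewrite mulr_ge0 ?weight_ge0// exprn_ge0// ltW.
Qed.

(** The inverse injection adds [descents_from s], which is at most [n]; this is why the
    alphabet grows by [n]. *)
Lemma sorted_mass_ge n N (s : 'S_n) :
  q ^+ imaj s * decreasing_mass n N <= sorted_mass (N + n) s.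
Proof.
rewrite /decreasing_mass mulr_sumr.
have add_lt (b : {ffun 'I_n -> 'I_N}) i : (b i + descents_from s i < N + n)%N.
  by rewrite -addSn leq_add// descents_from_le.
pose h (b : {ffun 'I_n -> 'I_N}) := [ffun x => Ordinal (add_lt b (s^-1 x)%g)].
apply: (@ler_sum_inj _ _ _ _ _ h) => [b c _ _ /ffunP hbc|b db|b _|w].
- apply/ffunP => i; have := hbc (s i); rewrite !ffunE permK => -[/eqP].
  by rewrite eqn_add2r => /eqP/val_inj.
- rewrite (_ : (fun x => _) =
    (fun x => b (s^-1 x)%g + descents_from s (s^-1 x)%g)%N).
    exact: (decreasing_sorts s db).
  by apply/funext => x; rewrite ffunE.
- rewrite /weight -exprD -sum_descents_from -big_split /=.
  rewrite [in RHS](reindex_inj (@perm_inj _ s))/=; congr (_ ^+ _); apply: eq_bigr => i _.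
  by rewrite ffunE /= permK addnC.
- exact: weight_ge0.
Qed.

Lemma letter_sumE N : letter_sum N = (1 - q ^+ N) / (1 - q).
Proof.
apply/esym; apply: (canLR (mulfK _)); first by rewrite subr_eq0 gt_eqF.
by rewrite -[LHS]opprB subrX1 -mulNr opprB mulrC.
Qed.

Lemma cvg_letter_sum : (letter_sum N @[N --> \oo] --> (1 - q)^-1).
Proof.
rewrite (_ : (fun N => _) = (fun N => (1 - q ^+ N) / (1 - q))); last first.
  by apply/funext => N; rewrite letter_sumE.
suff : (1 - q ^+ N) / (1 - q) @[N --> \oo] --> (1 - 0) / (1 - q) by rewrite subr0 mul1r.
apply: cvgM; last exact: cvg_cst.
by apply: cvgB; [exact: cvg_cst|apply: cvg_expr; rewrite gtr0_norm].
Qed.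

Lemma letter_sum_le N : letter_sum N <= (1 - q)^-1.
Proof.
rewrite letter_sumE ler_piMl ?invr_ge0 ?subr_ge0 ?(ltW q1)//.
by rewrite gerBl exprn_ge0// ltW.
Qed.

Lemma letter_sum_ge0 N : 0 <= letter_sum N.
Proof. by apply: sumr_ge0 => i _; rewrite exprn_ge0// ltW. Qed.

(** The sorting permutation of a word of independent geometric letters has
    exactly the major-index law.  By the two previous bounds the mass of [s] tends to
    [q ^+ imaj s * h] with [h] independent of [s], and the normalisation is forced
    because the masses of all permutations add up to the total weight. *)
Lemma cvg_sorted_mass n (s : 'S_n) :
  (sorted_mass N s / letter_sum N ^+ n @[N --> \oo] --> imaj_pmf q s).
Proof.
have q1' : 1 - q != 0 by rewrite subr_eq0 gt_eqF.
have cvgH : cvgn (decreasing_mass n).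
  apply: nondecreasing_is_cvgn; first exact: decreasing_mass_mono.
  exists ((1 - q)^-1 ^+ n) => _ [N _ <-].
  apply: le_trans (lerXn2r n _ _ (letter_sum_le N)); rewrite ?nnegrE ?letter_sum_ge0//;
    last by rewrite invr_ge0 subr_ge0 ltW.
  rewrite -sum_weight [leRHS](bigID (fun b : {ffun 'I_n -> 'I_N} => decreasing (fun x => b x)))/=.
  by rewrite lerDl sumr_ge0// => b _; exact: weight_ge0.
set h := limn (decreasing_mass n) in cvgH.
have cvgZ (t : 'S_n) : (sorted_mass N t @[N --> \oo] --> q ^+ imaj t * h).
  rewrite -(cvg_shiftn n).
  apply: (@squeeze_cvgr _ _ _ _ (fun N => q ^+ imaj t * decreasing_mass n N)
    (fun N => q ^+ imaj t * decreasing_mass n (N + n))).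
  - by apply: nearW => N; rewrite sorted_mass_ge sorted_mass_le.
  - exact: cvgMr.
  - by apply: cvgMr; rewrite (cvg_shiftn n (decreasing_mass n)).
have cvgT : (letter_sum N ^+ n @[N --> \oo] --> (1 - q)^-1 ^+ n).
  by apply: (@cvg_comp _ _ _ letter_sum (fun x : R => x ^+ n) _ _ _ cvg_letter_sum);
    exact: exprn_continuous.
have massE : (\sum_(t : 'S_n) q ^+ imaj t) * h = (1 - q)^-1 ^+ n.
  rewrite mulr_suml; apply: cvg_unique cvgT; first exact: Rhausdorff.
  rewrite (_ : (fun N => _) = (fun N => \sum_(t : 'S_n) sorted_mass N t)).
    by apply: cvgn_sum => t; exact: cvgZ.
  by apply/funext => N; rewrite sum_sorts sum_weight.
have h0 : h != 0.
  by apply: contra_eq_neq massE => ->; rewrite mulr0 eq_sym expf_neq0// invr_neq0.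
have S0 := imaj_partition_gt0 q0 n.
rewrite /imaj_pmf (_ : _ / _ = q ^+ imaj s * h / (1 - q)^-1 ^+ n); last first.
  by rewrite -massE; field; rewrite h0 gt_eqF.
apply: cvgM; first exact: cvgZ.
by apply: cvgV => //; rewrite expf_neq0// invr_neq0.
Qed.

End weights.

(** * Binomial means *)

Section binomial_mean.
Context {R : realType}.
Implicit Types (p c : R) (V : nat -> R).

Definition binomial_mean p n V : R :=
  \sum_(j < n.+1) 'C(n, j)%:R * p ^+ j * (1 - p) ^+ (n - j) * V j.

Lemma binomial_mean0 p V : binomial_mean p 0 V = V 0%N.
Proof. by rewrite /binomial_mean big_ord1 bin0 !expr0 !mul1r. Qed.

Lemma binomial_meanS p n V : binomial_mean p n.+1 V =
  p * binomial_mean p n (fun j => V j.+1) + (1 - p) * binomial_mean p n V.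
Proof.
rewrite /binomial_mean big_ord_recl /=.
under eq_bigr => i _.
  rewrite /bump /= add1n binS natrD subSS !mulrDl; over.
rewrite big_split /= addrA addrC; congr (_ + _).
  rewrite mulr_sumr; apply: eq_bigr => i _.
  by rewrite exprS; ring.
rewrite big_ord_recr /= (bin_small (ltnSn n)) !mul0r addr0 [in RHS]big_ord_recl mulrDr.
congr (_ + _); first by rewrite !bin0 !subn0 !expr0 !mul1r exprS !mulrA.
rewrite mulr_sumr; apply: eq_bigr => i _.
rewrite /= (_ : n - i = (n - i.+1).+1)%N; last by have := ltn_ord i; lia.
by rewrite [(1 - p) ^+ _.+1]exprS; ring.
Qed.

Lemma binomial_meanD p n V W :
  binomial_mean p n (fun j => V j + W j) = binomial_mean p n V + binomial_mean p n W.
Proof. by rewrite /binomial_mean -big_split; apply: eq_bigr => j _; rewrite mulrDr. Qed.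

Lemma binomial_meanZ p n c V :
  binomial_mean p n (fun j => c * V j) = c * binomial_mean p n V.
Proof. by rewrite /binomial_mean mulr_sumr; apply: eq_bigr => j _; rewrite mulrCA. Qed.

Lemma binomial_meanB p n V W :
  binomial_mean p n (fun j => V j - W j) = binomial_mean p n V - binomial_mean p n W.
Proof.
rewrite -[in RHS]mulN1r -binomial_meanZ -binomial_meanD.
by congr binomial_mean; apply/funext => j; rewrite mulN1r.
Qed.

Lemma binomial_mean_cst p n c : binomial_mean p n (fun=> c) = c.
Proof.
elim: n => [|n IH]; first by rewrite binomial_mean0.
by rewrite binomial_meanS !IH -mulrDl subrKC mul1r.
Qed.

Lemma le_binomial_mean p n V W : 0 <= p <= 1 -> (forall j, V j <= W j) ->
  binomial_mean p n V <= binomial_mean p n W.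
Proof.
move=> /andP[p0 p1] VW; apply: ler_sum => j _; apply: ler_wpM2l => //.
by rewrite !mulr_ge0 ?ler0n ?exprn_ge0// subr_ge0.
Qed.

(** Stein's identity for the binomial law, by induction on the number of trials: the
    last trial contributes one copy of the right-hand side through its own
    variance, and the other trials contribute the induction hypothesis. *)
Lemma binomial_stein p n V :
  binomial_mean p n.+1 (fun j => (j%:R - n.+1%:R * p) * V j) =
  n.+1%:R * (p * (1 - p)) * binomial_mean p n (fun j => V j.+1 - V j).
Proof.
elim: n V => [|n IH] V.
  by rewrite binomial_meanS !binomial_mean0; ring.
have shifted : binomial_mean p n.+1 (fun j => (j.+1%:R - n.+2%:R * p) * V j.+1) =
    n.+1%:R * (p * (1 - p)) * binomial_mean p n (fun j => V j.+2 - V j.+1) +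
    (1 - p) * binomial_mean p n.+1 (fun j => V j.+1).
  rewrite -(IH (fun j => V j.+1)) -binomial_meanZ -binomial_meanD.
  by congr binomial_mean; apply/funext => j; rewrite -[j.+1%:R]natr1 -[n.+2%:R]natr1; ring.
have unshifted : binomial_mean p n.+1 (fun j => (j%:R - n.+2%:R * p) * V j) =
    n.+1%:R * (p * (1 - p)) * binomial_mean p n (fun j => V j.+1 - V j) -
    p * binomial_mean p n.+1 V.
  rewrite -(IH V) -binomial_meanZ -binomial_meanB.
  by congr binomial_mean; apply/funext => j; rewrite -[n.+2%:R]natr1; ring.
rewrite binomial_meanS shifted unshifted !binomial_meanB.
rewrite (binomial_meanS p n V) (binomial_meanS p n (fun j => V j.+1)) -[n.+2%:R]natr1.
ring.
Qed.

Lemma binomial_variance p n :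
  binomial_mean p n (fun j => (j%:R - n%:R * p) ^+ 2) = n%:R * (p * (1 - p)).
Proof.
case: n => [|n]; first by rewrite binomial_mean0; ring.
under [X in binomial_mean _ _ X]eq_fun do rewrite expr2.
rewrite binomial_stein (_ : (fun j => _) = (fun=> 1)) ?binomial_mean_cst ?mulr1//.
by apply/funext => j; rewrite -natr1; ring.
Qed.

Lemma cvg_binomial_mean (u : nat -> R) p n V : u N @[N --> \oo] --> p ->
  binomial_mean (u N) n V @[N --> \oo] --> binomial_mean p n V.
Proof.
move=> up; rewrite /binomial_mean; apply: cvgn_sum => j.
have cvgX (v : nat -> R) (l : R) k : v N @[N --> \oo] --> l -> v N ^+ k @[N --> \oo] --> l ^+ k.
  by move=> vl; apply: (@cvg_comp _ _ _ v (fun x : R => x ^+ k) _ _ _ vl); exact: exprn_continuous.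
apply: cvgM; last exact: cvg_cst.
apply: cvgM; last by apply: cvgX; apply: cvgB => //; exact: cvg_cst.
by apply: cvgM; [exact: cvg_cst|exact: cvgX].
Qed.

End binomial_mean.

(** * Comparison with the number of zeros *)

Section comparison.
Context {R : realType}.
Variable q : R.
Hypotheses (q0 : 0 < q) (q1 : q < 1).

Lemma letter_tail_sum m N :
  (1 - q) * \sum_(a < N | (m <= a)%N) q ^+ a <= q ^+ m.
Proof.
suff -> : (1 - q) * \sum_(a < N | (m <= a)%N) q ^+ a = q ^+ m - q ^+ (maxn m N).
  by rewrite gerBl exprn_ge0// ltW.
elim: N => [|N IH]; first by rewrite big_ord0 mulr0 maxn0 subrr.
rewrite big_mkcond big_ord_recr -big_mkcond /= mulrDr IH.
case: leqP => [mN|Nm]; last first.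
  by rewrite mulr0 addr0 (maxn_idPl Nm).
by rewrite (maxn_idPr (leqW mN)) exprS; ring.
Qed.

(** Letters from [M] on are merged into one letter; this hypothesis makes [q] times
    the probability of [0] at least the probability of the merged letter. *)
Variable M : nat.
Hypothesis qM : q ^+ M <= q * (1 - q).

Let M_gt0 : (0 < M)%N.
Proof.
rewrite lt0n; apply: contraTneq qM => ->; rewrite expr0 -ltNge.
by have qq := mulr_gt0 q0 q0; move: q0 q1 => *; nra.
Qed.

(** Rewarding a match with the letter [c] by [q^-1] and a zero by [q] does not
    increase the mean, because [0] is more likely than any other merged letter by a
    factor at least [q^-1]: the gain [(q^-1 - 1) * q] is at most the loss [1 - q]. *)
Lemma letter_match_sum N c : (c <= M)%N ->
  \sum_(a < N) q ^+ a * (q^-1 ^+ (minn a M == c) * q ^+ (a == 0 :> nat)%N) <=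
  letter_sum q N.
Proof.
move=> cM; rewrite /letter_sum; case: c cM => [|c] cM.
  rewrite le_eqVlt; apply/orP; left; apply/eqP; apply: eq_bigr => a _.
  rewrite (_ : minn a M == 0%N = (a == 0 :> nat)%N); last by move: M_gt0; lia.
  by case: eqP => _; rewrite ?expr1 ?mulVf ?mulr1 ?gt_eqF// !expr0 !mulr1.
(* For c > 0 the letters matching c have total weight at most q. *)
have match_sum : \sum_(a < N | minn a M == c.+1) q ^+ a <= q.
  have [cltM|Mc] := ltnP c.+1 M.
    rewrite (eq_bigl (fun a : 'I_N => a == c.+1 :> nat)) => [|a]; last by lia.
    rewrite big_ord1_eq; case: ifP => _; last exact: ltW.
    by rewrite exprS ler_piMr ?exprn_ile1 ?ltW.
  have -> : c.+1 = M by apply/eqP; rewrite eqn_leq cM Mc.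
  rewrite (eq_bigl (fun a : 'I_N => (M <= a)%N)) => [|a]; last by lia.
  rewrite -(@ler_pM2l _ (1 - q)) ?subr_gt0//.
  by apply: le_trans (letter_tail_sum _ _) _; rewrite mulrC.
case: N match_sum => [|N] match_sum; first by rewrite !big_ord0.
have termE (a : 'I_N.+1) : q ^+ a * (q^-1 ^+ (minn a M == c.+1) * q ^+ (a == 0 :> nat)%N) =
    q ^+ a + (q^-1 - 1) * (if minn a M == c.+1 then q ^+ a else 0) - (1 - q) * (a == 0 :> nat)%N%:R.
  have [->|a0] := eqVneq (nat_of_ord a) 0%N.
    by rewrite min0n /= !expr0 !expr1; ring.
  by case: ifP => _; rewrite ?expr1 ?expr0 /=; ring.
rewrite (eq_bigr _ (fun a _ => termE a)) big_split /= big_split /= -mulr_sumr -big_mkcond /=.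
rewrite -addrA gerDl sumrN -mulr_sumr big_ord_recl /= big1_eq addr0 mulr1 subr_le0.
have -> : 1 - q = (q^-1 - 1) * q by rewrite mulrBl mulVf ?gt_eqF// mul1r.
by rewrite ler_wpM2l// subr_ge0 invf_ge1 ?ltW.
Qed.

(** Exponential moment bound for one staircase: the letters are independent, so
    [letter_match_sum] applies to each position. *)
Lemma sum_matches n N (t : {ffun 'I_M -> 'I_n.+1}) :
  \sum_(w : {ffun 'I_n -> 'I_N}) weight q w * (q^-1 ^+ matches t w * q ^+ zeros w) <=
  letter_sum q N ^+ n.
Proof.
under eq_bigr => w _.
  rewrite weight_prod /matches /zeros !expr_sum -!big_split /=; over.
rewrite -(bigA_distr_bigA (fun (x : 'I_n) (a : 'I_N) =>
  q ^+ a * (q^-1 ^+ (minn a M == staircase t x) * q ^+ (a == 0 :> nat)%N))).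
rewrite -[n in leRHS]card_ord -prodr_const; apply: ler_prod => x _.
apply/andP; split.
  by apply: sumr_ge0 => a _; rewrite !mulr_ge0// exprn_ge0// ?invr_ge0 ltW.
apply: letter_match_sum; rewrite -[leqRHS]card_ord -sum1_card /staircase.
by apply: leq_sum => v _; case: ltnP.
Qed.

(** The number of zeros is binomial; the generating polynomial of the weights in
    a variable marking zeros is [(T - 1 + 'X) ^+ n],
    where [T] is the total weight of a letter. *)
Lemma sum_weight_zeros n N V : (0 < N)%N ->
  \sum_(w : {ffun 'I_n -> 'I_N}) weight q w * V (zeros w) =
  letter_sum q N ^+ n * binomial_mean (letter_sum q N)^-1 n V.
Proof.
move=> N0; set T := letter_sum q N.
have TE : T = 1 + (T - 1) by rewrite subrKC.
have T0 : T != 0.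
  rewrite gt_eqF// /T /letter_sum; case: N N0 {T TE} => // N _.
  by rewrite big_ord_recl expr0 ltr_pwDl// sumr_ge0// => a _; rewrite exprn_ge0// ltW.
pose P (w : {ffun 'I_n -> 'I_N}) : {poly R} := (weight q w)%:P * 'X^(zeros w).
have PE : \sum_w P w = ((T - 1)%:P + 'X) ^+ n.
  rewrite -[n in RHS]card_ord -prodr_const.
  rewrite (eq_bigr (fun w : {ffun 'I_n -> 'I_N} =>
      \prod_(x < n) ((q ^+ w x)%:P * 'X^(w x == 0 :> nat)))) => [|w _]; last first.
    by rewrite /P weight_prod rmorph_prod /zeros expr_sum -big_split.
  rewrite -(bigA_distr_bigA (fun (x : 'I_n) (a : 'I_N) =>
    (q ^+ a)%:P * 'X^(a == 0 :> nat) : {poly R})).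
  apply: eq_bigr => x _; rewrite /T /letter_sum; case: N N0 {T TE T0 P} => // N _.
  rewrite !big_ord_recl /= !expr0 expr1 mul1r addrC; congr (_ + _).
  by rewrite addrAC subrr add0r rmorph_sum; apply: eq_bigr => a _; rewrite mulr1.
transitivity (\sum_(j < n.+1) (\sum_w P w)`_j * V j).
  under [RHS]eq_bigr => j _ do rewrite coef_sum mulr_suml.
  rewrite exchange_big /=; apply: eq_bigr => w _.
  rewrite (bigD1 (Ordinal (zeros_le w : (zeros w < n.+1)%N)))//=.
  rewrite coefCM coefXn eqxx mulr1 big1 ?addr0// => j jw.
  by rewrite coefCM coefXn (_ : _ == _ = false) ?mulr0 ?mul0r//; apply/negbTE.
rewrite PE mulr_sumr; apply: eq_bigr => j _.
rewrite exprDn coef_sum (bigD1 j)//= big1 ?addr0 => [|i ij]; last first.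
  rewrite coefMn -rmorphXn coefCM coefXn (_ : _ == _ = false) ?mulr0 ?mul0rn//.
  by rewrite eq_sym; apply/negbTE.
rewrite coefMn -rmorphXn coefCM coefXn eqxx mulr1 !mulrA; congr (_ * _).
have -> : 1 - T^-1 = (T - 1) / T by rewrite mulrBl divff// mul1r.
rewrite expr_div_n -mulr_natl -[n in T ^+ n](subnK (leq_ord j)) exprD exprVn.
by field; rewrite !expf_neq0.
Qed.

(** [V] controls [F] across gaps shorter than [k]; longer gaps cost at most [B]. *)
Variables (n k : nat) (F V : nat -> R) (B : R).
Hypotheses (B0 : 0 <= B)
  (FV_near : forall i j, (i <= j <= n)%N -> (j < i + k)%N -> F j <= V i)
  (FV_far : forall i j, (i <= j <= n)%N -> F j <= V i + B).

Let sum_lis_le N : (0 < N)%N ->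
  \sum_(s : 'S_n) F (lis s) * sorted_mass q N s <=
  letter_sum q N ^+ n *
    (binomial_mean (letter_sum q N)^-1 n V + B * q ^+ k * n.+1%:R ^+ M).
Proof.
move=> N0; have q0' := ltW q0; have qV0 : 0 <= q^-1 by rewrite invr_ge0.
pose G (w : {ffun 'I_n -> 'I_N}) := V (zeros w) +
  B * q ^+ k * \sum_(t : {ffun 'I_M -> 'I_n.+1}) q^-1 ^+ matches t w * q ^+ zeros w.
have FG s (w : {ffun 'I_n -> 'I_N}) : sorts s (fun x => w x) -> F (lis s) <= G w.
  move=> sw; have zn : (zeros w <= lis s <= n)%N by rewrite zeros_le_lis// lis_le.
  have sum0 : 0 <= \sum_(t : {ffun 'I_M -> 'I_n.+1}) q^-1 ^+ matches t w * q ^+ zeros w.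
    by apply: sumr_ge0 => t _; rewrite mulr_ge0 ?exprn_ge0.
  have [near|far] := ltnP (lis s) (zeros w + k).
    by rewrite /G (le_trans (FV_near zn near))// lerDl !mulr_ge0// exprn_ge0.
  (* The staircase matching lis s letters contributes
     q^-1 ^+ lis s * q ^+ zeros w >= q^-1 ^+ k. *)
  apply: (le_trans (FV_far zn)); rewrite lerD2l -mulrA ler_peMr//.
  have [t lt] := lis_le_matches M sw.
  rewrite (bigD1 t)//= mulrDr ler_wpDr//.
    by rewrite mulr_ge0 ?exprn_ge0// sumr_ge0// => ? _; rewrite mulr_ge0 ?exprn_ge0.
  rewrite mulrCA -exprD exprVn mulrC ler_pdivlMr ?exprn_gt0// mul1r.
  by rewrite ler_wiXn2l// ?ltW// addnC (leq_trans far).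
apply: (@le_trans _ _ (\sum_(w : {ffun 'I_n -> 'I_N}) weight q w * G w)).
  rewrite -(sum_sorts (fun w => weight q w * G w)); apply: ler_sum => s _.
  rewrite mulrC /sorted_mass mulr_suml; apply: ler_sum => w /FG FGw.
  by rewrite ler_wpM2l// weight_ge0.
rewrite /G; under eq_bigr do rewrite mulrDr mulrCA.
rewrite big_split /= sum_weight_zeros// mulrDr lerD2l -mulr_sumr mulrCA ler_wpM2l//.
  by rewrite mulr_ge0// exprn_ge0.
under eq_bigr do rewrite mulr_sumr.
rewrite exchange_big /= mulrC -natrX -[X in (_ ^ X)%N]card_ord -[X in (X ^ _)%N]card_ord.
rewrite -card_ffun -sum1_card natr_sum mulr_suml; apply: ler_sum => t _.
by rewrite mul1r sum_matches.
Qed.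

(** The longest increasing subsequence exceeds the binomial number of zeros by [k] with
    probability at most [q ^+ k * n.+1 ^+ M]: exponential Markov inequality, and a union
    bound over the staircases. *)
Lemma lis_mean_le :
  \sum_(s : 'S_n) imaj_pmf q s * F (lis s) <=
  binomial_mean (1 - q) n V + B * q ^+ k * n.+1%:R ^+ M.
Proof.
have q1' : 1 - q != 0 by rewrite subr_eq0 gt_eqF.
apply: (@ler_cvg_to nat \oo _ R
  (fun N => \sum_(s : 'S_n) (sorted_mass q N s / letter_sum q N ^+ n) * F (lis s))
  (fun N => binomial_mean (letter_sum q N)^-1 n V + B * q ^+ k * n.+1%:R ^+ M)).
- apply: cvgn_sum => s; apply: cvgM; last exact: cvg_cst.
  exact: cvg_sorted_mass.
- apply: cvgD; last exact: cvg_cst.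
  apply: cvg_binomial_mean; rewrite -[X in _ --> X]invrK; apply: cvgV.
    by rewrite invr_neq0.
  exact: cvg_letter_sum.
- near=> N; have N0 : (0 < N)%N by near: N; exact: nbhs_infty_gt.
  have T0 : 0 < letter_sum q N.
    rewrite letter_sumE// divr_gt0 ?subr_gt0// exprn_ilt1// ?lt0n_neq0 ?ltW//.
  rewrite -(@ler_pM2l _ (letter_sum q N ^+ n)) ?exprn_gt0//.
  apply: le_trans (sum_lis_le N0); rewrite mulr_sumr; apply: ler_sum => s _.
  by rewrite mulrA mulrCA divff ?mulr1 1?mulrC// gt_eqF// exprn_gt0.
Unshelve. all: by end_near. Qed.

End comparison.

(** * Stein's equation for the centered normal law *)

Section stein_equation.
Context {R : realType}.
Variable s : R.
Hypothesis s0 : s != 0.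
Local Notation mu := (@lebesgue_measure R).
Local Notation N0s := (@normal_prob R 0 s).
Local Notation phi := (@normal_pdf R 0 s).

Lemma integral_normal_prob (f : R -> \bar R) :
  N0s.-integrable [set: R] f ->
  (\int[N0s]_x f x = \int[mu]_x (f x * (phi x)%:E))%E.
Proof.
move=> intf; have mf := measurable_int _ intf.
have dom := normal_prob_dominates (0 : R) s.
have mphi : measurable_fun [set: R] (EFin \o phi).
  by apply/measurable_EFinP; exact: measurable_normal_pdf.
rewrite -(Radon_Nikodym_change_of_variables dom)//.
apply: ae_eq_integral => //.
- apply: (emeasurable_funM mf); apply: (measurable_int mu).
  exact: Radon_Nikodym_integrable.
- exact: emeasurable_funM mf mphi.
- apply: ae_eqe_mul2l => /=.
  rewrite Radon_NikodymE//=.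
  case: cid => /= h [h1 h2 h3].
  apply: integral_ae_eq => //=.
  + by move=> E _ mE; rewrite -h3.
Qed.

Let phiE x : phi x = normal_peak s * expR (- (2 * s ^+ 2)^-1 * x ^+ 2).
Proof.
rewrite normal_pdfE// /normal_fun subr0; congr (_ * expR _).
by rewrite -mulr_natl mulrC mulNr mulrN mulrC.
Qed.

Let phi_gt0 x : 0 < phi x.
Proof. by rewrite phiE mulr_gt0 ?expR_gt0 ?normal_peak_gt0. Qed.

Let is_derive_gauss (c x : R) :
  is_derive x 1 (fun t : R => expR (c * t ^+ 2)) (2 * c * x * expR (c * x ^+ 2)).
Proof.
have dsq : is_derive x 1 (fun t : R => t ^+ 2) (x *: 1 + x *: 1).
  exact: (is_deriveM (is_derive_id x 1) (is_derive_id x 1)).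
have dc : is_derive x 1 (fun t : R => c * t ^+ 2) (c *: (x *: 1 + x *: 1)).
  exact: (is_deriveZ c dsq).
have de : is_derive x 1 (fun t : R => expR (c * t ^+ 2))
    (expR (c * x ^+ 2) * (c *: (x *: 1 + x *: 1))).
  exact: (@is_derive1_comp R expR (fun t => c * t ^+ 2) x _ _ (is_derive_expR _) dc).
apply: (is_derive_eq de).
by rewrite /GRing.scale /=; ring.
Qed.

Lemma is_derive_normal_pdf (x : R) : is_derive x 1 phi (- (x / s ^+ 2) * phi x).
Proof.
rewrite (_ : phi = fun t => normal_peak s *: expR (- (2 * s ^+ 2)^-1 * t ^+ 2)); last first.
  by apply/funext => t; rewrite phiE.
apply: (is_derive_eq (is_deriveZ (normal_peak s) (is_derive_gauss _ x))).
by rewrite /GRing.scale /= invfM; field.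
Qed.

Let continuous_phi : continuous phi. Proof. exact: continuous_normal_pdf. Qed.

Let cvg_phi_y : phi x @[x --> +oo] --> 0.
Proof.
rewrite (_ : phi = fun t => normal_peak s * expR (- ((2 * s ^+ 2)^-1 * t ^+ 2))); last first.
  by apply/funext => t; rewrite phiE mulNr.
rewrite -[X in _ --> X](mulr0 (normal_peak s)); apply: cvgMr.
apply: (cvg_comp (fun x : R => (2 * s ^+ 2)^-1 * x ^+ 2) (fun x => expR (- x))).
  apply: gt0_cvgMry; last exact: cvgr_expr2.
  by rewrite invr_gt0 mulr_gt0// exprn_even_gt0.
exact: cvgr_expR.
Qed.

(** Mills' inequality: on [[x, +oo[] the density is at most [t / x] times itself,
    and [t * phi t] is the derivative of [- s ^+ 2 * phi t]. *)
Lemma normal_tail_le (x : R) : 0 < x ->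
  \int[mu]_(t in `[x, +oo[) phi t <= s ^+ 2 * phi x / x.
Proof.
move=> x0.
have s2 : s ^+ 2 != 0 by rewrite expf_neq0.
have int_phi : mu.-integrable `[x, +oo[ (EFin \o phi).
  by apply: (integrableS _ _ (@subsetT _ _)) => //; exact: integrable_normal_pdf.
have tail : (\int[mu]_(t in `[x, +oo[) (t / x * phi t)%:E =
    0%:E - (- (s ^+ 2 / x) * phi x)%:E)%E.
  apply: (@ge0_continuous_FTC2y _ _ (fun t => - (s ^+ 2 / x) * phi t)).
  - move=> t xt; rewrite mulr_ge0 ?(ltW (phi_gt0 t))// divr_ge0 ?(ltW x0)//.
    exact: le_trans (ltW x0) xt.
  - apply: continuous_subspaceT => t; apply: cvgM; last exact: continuous_phi.
    by apply: cvgM; [exact: cvg_id|exact: cvg_cst].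
  - by rewrite -[X in _ --> X](mulr0 (- (s ^+ 2 / x))); apply: cvgMr.
  - by move=> t _; apply: derivableM => //; apply: ex_derive; exact: is_derive_normal_pdf.
  - by apply: cvg_at_right_filter; apply: cvgM; [exact: cvg_cst|exact: continuous_phi].
  - move=> t _; rewrite derive1E.
    have dF := is_deriveZ (- (s ^+ 2 / x)) (is_derive_normal_pdf t).
    rewrite (@derive_val _ _ _ _ _ _ _ dF) /GRing.scale /=.
    by field; rewrite s0 gt_eqF.
have -> : s ^+ 2 * phi x / x = fine (0%:E - (- (s ^+ 2 / x) * phi x)%:E)%E.
  by rewrite /= sub0r mulNr opprK; ring.
rewrite -tail /Rintegral fine_le//.
- exact: integrable_fin_num.
- by rewrite tail.
apply: ge0_le_integral => //.
- by move=> t _; rewrite lee_fin ltW.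
- exact: (measurable_int mu).
- apply/measurable_EFinP; apply: measurable_funM; first exact: measurable_funM.
  by apply: measurable_funTS; exact: measurable_normal_pdf.
- move=> t /=; rewrite in_itv/= andbT => xt.
  by rewrite lee_fin ler_peMl ?(ltW (phi_gt0 t))// ler_pdivlMr// mul1r.
Qed.

Lemma normal_tailNy_le (x : R) : x < 0 ->
  \int[mu]_(t in `]-oo, x]) phi t <= s ^+ 2 * phi x / - x.
Proof.
move=> x0.
have phiN t : phi (- t) = phi t by rewrite !phiE sqrrN.
have := @normal_tail_le (- x); rewrite oppr_gt0 => /(_ x0); rewrite phiN.
apply: le_trans; rewrite le_eqVlt; apply/orP; left; apply/eqP.
rewrite /Rintegral; congr fine.
have := @ge0_integration_by_substitutionNy _ phi (- x); rewrite opprK => ->.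
- by apply: eq_integral => t _ /=; rewrite phiN.
- exact: continuous_subspaceT.
- by move=> t _; exact: ltW.
Qed.

Variable h : R -> R.
Hypotheses (ch : continuous h) (bh : bounded_fun h).

(** Stein's equation says that [s ^+ 2 * phi * f] has derivative [(h - m) * phi].  The
    solution taken is the primitive vanishing at both ends of the line, which
    exists because [h - m] has mean zero; Mills' inequality then bounds [x * f x] and, by
    the equation, [f']. *)
Lemma stein_solution (m : R) : m%:E = (\int[N0s]_x (h x)%:E)%E ->
  exists f f' : R -> R, [/\ forall x : R, is_derive x 1 f (f' x),
    continuous f', exists C, forall x, `|f' x| <= C &
    forall x, s ^+ 2 * f' x - x * f x = h x - m].
Proof.
move=> mE.
have s2 : 0 < s ^+ 2 by rewrite exprn_even_gt0.
have mh : measurable_fun [set: R] h by exact: continuous_measurable_fun.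
have [H hH] : exists H, forall x, `|h x| <= H.
  have [H [_ hH]] := bh; exists (H + 1) => x; by apply: hH => //; rewrite ltrDl.
pose g x := h x - m.
pose D := H + `|m|.
have gD x : `|g x| <= D by rewrite (le_trans (ler_normB _ _))// lerD2r.
have cg : continuous g by move=> x; apply: cvgB; [exact: ch|exact: cvg_cst].
pose gp x := g x * phi x.
have cgp : continuous gp by move=> x; apply: cvgM; [exact: cg|exact: continuous_phi].
have mphi := measurable_normal_pdf (0 : R) s.
have int_phi := integrable_normal_pdf (0 : R) s.
have int_gp : mu.-integrable [set: R] (EFin \o gp).
  apply: (@le_integrable _ _ _ mu _ measurableT _ (fun x => D%:E * (phi x)%:E)%E).
  - by apply/measurable_EFinP; exact: continuous_measurable_fun.
  - move=> x _ /=; rewrite lee_fin /gp normrM [leRHS]normrM ler_wpM2r//.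
    by rewrite (le_trans (gD x))// ler_norm.
  - exact: integrableZl.
have int_h : N0s.-integrable [set: R] (EFin \o h).
  apply: measurable_bounded_integrable => //.
  exact: (le_lt_trans (probability_le1 _ _) (ltry _)).
have int_hp : mu.-integrable [set: R] (fun x => (h x * phi x)%:E).
  apply: (@le_integrable _ _ _ mu _ measurableT _ (fun x => H%:E * (phi x)%:E)%E).
  - by apply/measurable_EFinP; exact: measurable_funM.
  - move=> x _ /=; rewrite lee_fin normrM [leRHS]normrM ler_wpM2r//.
    by rewrite (le_trans (hH x))// ler_norm.
  - exact: integrableZl.
have int0 : \int[mu]_x gp x = 0.
  rewrite (_ : gp = fun x => h x * phi x - m * phi x); last first.
    by apply/funext => x; rewrite /gp /g mulrBl.
  rewrite RintegralB//; last exact: (integrableZl measurableT m int_phi).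
  rewrite RintegralZl// /Rintegral integral_normal_pdf mulr1.
  have := integral_normal_prob int_h; rewrite -mE => /esym /= ->.
  by rewrite subrr.
pose A x := \int[mu]_(t in `]-oo, x]) gp t.
have dA (x : R) : is_derive x 1 A (gp x).
  have [|//|||dAx Ax] := @continuous_FTC1 _ gp -oo%O x (x + 1).
  - by rewrite ltrDl.
  - exact: (integrableS _ _ (@subsetT _ _)).
  - by rewrite ltNyr.
  - exact: cgp.
  - by apply: DeriveDef => //; rewrite -Ax derive1E.
have A_le x : `|x * A x| <= D * (s ^+ 2 * phi x).
  have bound (B : set (measurableTypeR R)) : measurable B ->
      `|\int[mu]_(t in B) gp t| <= D * \int[mu]_(t in B) phi t.
    move=> mB; have int_gpB := integrableS measurableT mB (@subsetT _ B) int_gp.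
    have int_phiB := integrableS measurableT mB (@subsetT _ B) int_phi.
    apply: le_trans (le_normr_Rintegral mB int_gpB) _.
    rewrite -RintegralZl//; apply: le_Rintegral => //.
    - exact: integrable_norm int_gpB.
    - exact: (integrableZl mB D int_phiB).
    - by move=> t _; rewrite /gp normrM (gtr0_norm (phi_gt0 t)) ler_wpM2r// ltW.
  have D0 : 0 <= D by apply: le_trans (gD 0).
  have [x0|x0|->] := ltgtP x 0.
  - rewrite normrM ltr0_norm// mulrC -ler_pdivlMr ?oppr_gt0// -mulrA.
    apply: le_trans (bound _ _) _ => //.
    by rewrite ler_wpM2l// normal_tailNy_le.
  (* On the right half-line the primitive is minus the integral over the other side. *)
  - have -> : A x = - \int[mu]_(t in `]x, +oo[) gp t.
      rewrite -(@Rintegral_itvB _ _ -oo%O +oo%O) ?set_itvNyy ?bnd_simp//.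
      by rewrite int0 sub0r opprK.
    rewrite normrM gtr0_norm// normrN mulrC -ler_pdivlMr// -mulrA.
    apply: le_trans (bound _ _) _ => //.
    rewrite ler_wpM2l// Rintegral_itv_obnd_cbnd ?normal_tail_le//.
    exact: (integrableS _ _ (@subsetT _ _)).
  - by rewrite mul0r normr0 mulr_ge0// mulr_ge0 ?ltW.
(* E is the reciprocal of s ^+ 2 * phi in a form whose derivative is immediate. *)
pose E x := (s ^+ 2 * normal_peak s)^-1 * expR ((2 * s ^+ 2)^-1 * x ^+ 2).
have EE x : E x = (s ^+ 2 * phi x)^-1.
  by rewrite phiE /E mulNr expRN [in RHS]mulrA [RHS]invfM invrK.
have dE (x : R) : is_derive x 1 E (x / s ^+ 2 * E x).
  apply: (is_derive_eq (is_deriveZ (s ^+ 2 * normal_peak s)^-1 (is_derive_gauss _ x))).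
  by rewrite /E /GRing.scale /=; field; rewrite s0 gt_eqF ?normal_peak_gt0.
pose f x := A x * E x.
pose f' x := (g x + x * f x) / s ^+ 2.
have df (x : R) : is_derive x 1 f (f' x).
  apply: (is_derive_eq (is_deriveM (dA x) (dE x))).
  rewrite /GRing.scale /= /f' /f /gp EE.
  by field; rewrite s0 gt_eqF.
exists f, f'; split => //.
- move=> x; apply: cvgM; last exact: cvg_cst.
  apply: cvgD; first exact: cg.
  apply: cvgM; first exact: cvg_id.
  by apply: differentiable_continuous; apply/derivable1_diffP; exact: ex_derive.
- exists ((D + D) / s ^+ 2) => x.
  rewrite /f' normrM [X in _ * X]gtr0_norm ?invr_gt0// ler_wpM2r ?invr_ge0 ?(ltW s2)//.
  apply: le_trans (ler_normD _ _) _; rewrite lerD// /f mulrA normrM EE.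
  have p0 : 0 < s ^+ 2 * phi x by rewrite mulr_gt0.
  rewrite [`|_^-1|]gtr0_norm ?invr_gt0// ler_pdivrMr//.
- by move=> x; rewrite /f' mulrCA divff ?mulr1 ?gt_eqF// addrK.
Qed.

End stein_equation.

(** * Central limit theorem for the binomial law *)

Section oscillation.
Context {R : realType}.

(** A bounded continuous function need not be uniformly continuous, but it is so on
    a segment [[-A, A]], and outside it the weight [x ^+ 2] dominates the crude bound
    [H + H].  The weight has a bounded mean under the laws used below. *)
Lemma oscillation_le (h : R -> R) (H e : R) : continuous h -> (forall x, `|h x| <= H) ->
  0 < e -> exists2 d : R, 0 < d &
    forall x y : R, `|y - x| <= d -> `|h y - h x| <= e * (1 + x ^+ 2).
Proof.
move=> ch hH e0.
have H0 : 0 <= H by apply: le_trans (hH 0).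
(* A is chosen so that e * A ^+ 2 = H + H. *)
pose A := Num.sqrt ((H + H) / e).
have A2 : A ^+ 2 = (H + H) / e by rewrite sqr_sqrtr// divr_ge0 ?addr_ge0 ?(ltW e0).
have near_d : \forall d \near 0^'+, `[- A, A] `<=`
    [set x | forall y : R, `|y - x| <= d -> `|h y - h x| <= e].
  have /compact_near_coveringP := @segment_compact R (- A) A.
  apply => x _; have e2 : 0 < e / 2 by rewrite divr_gt0.
  have /cvgrPdist_lt/(_ _ e2)/nbhs_ballP[r /= r0 hr] := ch x.
  exists (ball x (r / 2), [set d | d < r / 2]) => /=.
    split; first by apply: nbhsx_ballx; rewrite divr_gt0.
    by apply: nbhs_right_lt; rewrite divr_gt0.
  move=> [z d] /= [xz dr] y yz.
  have hz : `|h x - h z| < e / 2.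
    by apply: hr; apply: le_ball xz; rewrite ler_pdivrMr// ler_peMr ?ler1n// ltW.
  have hy : `|h x - h y| < e / 2.
    apply: hr; rewrite /ball /= (splitr r) -(subrKA z) (le_lt_trans (ler_normD _ _))//.
    by rewrite ltrD// distrC (le_lt_trans yz).
  rewrite -(subrKA (h x)) (le_trans (ler_normD _ _))// (splitr e) lerD//; last exact: ltW.
  by rewrite distrC ltW.
near (0 : R)^'+ => d.
exists d; first by near: d; exact: nbhs_right_gt.
move=> x y yx; have [xA|Ax] := leP `|x| A.
  apply: (@le_trans _ _ e); last by rewrite ler_peMr ?(ltW e0)// lerDl sqr_ge0.
  have sub : `[- A, A] `<=` [set x | forall y : R, `|y - x| <= d -> `|h y - h x| <= e].
    by near: d.
  by apply: sub yx; rewrite /= in_itv /= -ler_norml.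
apply: (@le_trans _ _ (H + H)).
  by rewrite (le_trans (ler_normB _ _))// lerD.
rewrite mulrC -ler_pdivrMr// -A2 (@le_trans _ _ (x ^+ 2))// ?lerDr//.
by rewrite -[x ^+ 2](real_normK (num_real x)) lerXn2r ?nnegrE ?sqrtr_ge0// ltW.
Unshelve. all: by end_near. Qed.

End oscillation.

Section binomial_clt.
Context {R : realType}.
Variable p : R.
Hypotheses (p0 : 0 < p) (p1 : p < 1).
Let v := p * (1 - p).

Let v0 : 0 < v. Proof. by rewrite mulr_gt0// subr_gt0. Qed.
Let v1 : v <= 1. Proof. by rewrite /v; move: p0 p1 => *; nra. Qed.
Let p01 : 0 <= p <= 1. Proof. by rewrite !ltW. Qed.

Definition standardized n (j : nat) : R := (j%:R - n%:R * p) / Num.sqrt n%:R.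

(** Stein's identity leaves [n] trials standardized as if there were [n.+1], which shifts
    the mean by [p]. *)
Lemma standardized_variance_le n :
  binomial_mean p n (fun j => standardized n.+1 j ^+ 2) <= 1.
Proof.
have r2 : Num.sqrt (n.+1%:R : R) ^+ 2 = n.+1%:R by rewrite sqr_sqrtr.
have centered : binomial_mean p n (fun j => j%:R - n%:R * p) = 0.
  case: n {r2} => [|n]; first by rewrite binomial_mean0; ring.
  rewrite (_ : (fun j => _) = (fun j => (j%:R - n.+1%:R * p) * 1)); last first.
    by apply/funext => j; rewrite mulr1.
  rewrite (binomial_stein p n (fun=> 1)) (_ : (fun j => _) = fun=> 0).
    by rewrite binomial_mean_cst mulr0.
  by apply/funext => j; rewrite subrr.
rewrite (_ : (fun j => _) = (fun j => n.+1%:R^-1 *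
    ((j%:R - n%:R * p) ^+ 2 + (- (2 * p)) * (j%:R - n%:R * p) + p ^+ 2))); last first.
  by apply/funext => j; rewrite /standardized expr_div_n r2 -natr1; field; rewrite natr1.
rewrite binomial_meanZ !binomial_meanD binomial_variance binomial_meanZ centered.
rewrite binomial_mean_cst mulr0 addr0 ler_pdivrMl// mulr1 -natr1 lerD//.
  by rewrite ler_piMr.
by rewrite exprn_ile1// ltW.
Qed.

(** With [f] the solution of Stein's equation, the mean of [h - m] is that of
    [v * f' - x * f].  Stein's identity turns the second term into the mean of [v] times a
    difference quotient of [f], which is a value of [f'] at a point within [1 / Num.sqrt n%:R]. *)
Lemma binomial_clt (h : R -> R) (m : R) : continuous h -> bounded_fun h ->
  m%:E = (\int[normal_prob 0 (Num.sqrt v)]_y (h y)%:E)%E ->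
  binomial_mean p n (fun j => h (standardized n j)) @[n --> \oo] --> m.
Proof.
move=> ch bh mE.
have s0 : Num.sqrt v != 0 by rewrite gt_eqF// sqrtr_gt0.
have [f [f' [df cf' [C f'C] steinE]]] := stein_solution s0 ch bh mE.
rewrite sqr_sqrtr ?(ltW v0)// in steinE.
apply/cvgrPdist_le => e e0.
have e4 : 0 < e / 4 by rewrite divr_gt0.
have [d d0 osc] := oscillation_le cf' f'C e4.
near=> n'.
have [n n'E] : exists n, n' = n.+1.
  exists n'.-1; rewrite prednK//; near: n'; exact: nbhs_infty_gt.
have d_le : (Num.sqrt n.+1%:R)^-1 <= d.
  rewrite -n'E invf_ple ?posrE// ?sqrtr_gt0 ?ltr0n ?n'E// -n'E.
  have : d^-1 ^+ 2 <= n'%:R by near: n'; exact: nbhs_infty_ger.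
  by move=> /ler_wsqrtr; rewrite sqrtr_sqr ger0_norm ?invr_ge0 ?(ltW d0).
rewrite n'E distrC.
set r := Num.sqrt n.+1%:R in d_le *.
have r0 : 0 < r by rewrite sqrtr_gt0.
have r2 : r ^+ 2 = n.+1%:R by rewrite sqr_sqrtr.
pose X := standardized n.+1.
have XS j : X j.+1 = X j + r^-1.
  by rewrite /X /standardized -/r -natr1; ring.
pose slope j := r * (f (X j.+1) - f (X j)).
have slope_osc j : `|p * (f' (X j.+1) - slope j) + (1 - p) * (f' (X j) - slope j)| <=
    e / 2 * (1 + X j ^+ 2).
  have XX : X j < X j.+1 by rewrite XS ltrDl invr_gt0.
  have cf : {within `[X j, X j.+1], continuous f}.
    by apply: derivable_within_continuous => x _; exact: ex_derive.
  have [x xX fE] := MVT XX (fun x _ => df x) cf.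
  have -> : slope j = f' x.
    rewrite /slope fE XS [X j + _]addrC addrK mulrC.
    by rewrite -mulrA mulVf ?mulr1// gt_eqF.
  have oscS : `|f' (X j.+1) - f' (X j)| <= e / 4 * (1 + X j ^+ 2).
    by apply: osc; rewrite XS [X j + _]addrC addrK ger0_norm// invr_ge0 ltW.
  have oscx : `|f' x - f' (X j)| <= e / 4 * (1 + X j ^+ 2).
    move: xX; rewrite in_itv /= => /andP[xl xr]; apply: osc; move: xr.
    rewrite XS ger0_norm ?subr_ge0 ?(ltW xl)// => xr.
    by rewrite (le_trans _ d_le)// lerBlDl ltW.
  rewrite (_ : _ + _ = p * (f' (X j.+1) - f' (X j)) - (f' x - f' (X j))); last by ring.
  apply: (le_trans (ler_normB _ _)).
  rewrite (_ : e / 2 * _ = e / 4 * (1 + X j ^+ 2) + e / 4 * (1 + X j ^+ 2)); last by field.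
  rewrite lerD// normrM gtr0_norm// (le_trans _ oscS)// ler_piMl//.
  exact: ltW.
have -> : binomial_mean p n.+1 (fun j => h (X j)) - m =
    v * binomial_mean p n (fun j =>
      p * (f' (X j.+1) - slope j) + (1 - p) * (f' (X j) - slope j)).
  rewrite -[X in _ - X](binomial_mean_cst p n.+1) -binomial_meanB.
  under [X in binomial_mean _ _ X = _]eq_fun do rewrite -steinE.
  rewrite binomial_meanB binomial_meanZ binomial_meanS.
  rewrite (_ : (fun j => X j * f (X j)) =
      (fun j => r^-1 * ((j%:R - n.+1%:R * p) * f (X j)))); last first.
    by apply/funext => j; rewrite /X /standardized -/r; ring.
  rewrite binomial_meanZ (binomial_stein p n (fun j => f (X j))) -r2 -/v.
  rewrite (_ : r^-1 * _ = v * binomial_mean p n slope); last first.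
    by rewrite /slope binomial_meanZ; field; rewrite gt_eqF.
  rewrite -mulrBr; congr (v * _).
  rewrite [X in _ = binomial_mean _ _ X](_ : _ = (fun j =>
    (p * f' (X j.+1) + (1 - p) * f' (X j)) - slope j)); last first.
    by apply/funext => j; ring.
  by rewrite binomial_meanB binomial_meanD !binomial_meanZ.
rewrite normrM gtr0_norm// (@le_trans _ _ (1 * (e / 2 * 2)))//; last first.
  by rewrite mul1r divfK.
apply: ler_pM => //; first exact: ltW.
have mean_le W : (forall j, W j <= e / 2 * (1 + X j ^+ 2)) ->
    binomial_mean p n W <= e / 2 * 2.
  move=> WX; apply: le_trans (le_binomial_mean n p01 WX) _.
  rewrite binomial_meanZ binomial_meanD binomial_mean_cst.
  rewrite ler_wpM2l ?divr_ge0 ?(ltW e0)// -natr1 lerD2l.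
  exact: standardized_variance_le.
rewrite ler_norml; apply/andP; split; last first.
  by apply: mean_le => j; exact: le_trans (ler_norm _) (slope_osc j).
rewrite lerNl -[leLHS]mulN1r -binomial_meanZ; apply: mean_le => j.
by rewrite mulN1r (le_trans (ler_norm _))// normrN.
Unshelve. all: by end_near. Qed.

End binomial_clt.

(** * Longest increasing subsequence under the major-index law *)

Section rates.
Context {R : realType}.

(** Splitting [q] into two square roots [t] trades one power of [k.+1] for the factor
    [k.+1%:R * t ^+ k], which the geometric series of [t] bounds. *)
Lemma polynomial_geometric_bounded (q : R) m : 0 < q -> q < 1 ->
  exists C : R, forall k, k.+1%:R ^+ m * q ^+ k <= C.
Proof.
elim: m q => [|m IH] q q0 q1.
  by exists 1 => k; rewrite expr0 mul1r exprn_ile1 ?(ltW q0) ?(ltW q1).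
set t := Num.sqrt q; have t0 : 0 < t by rewrite sqrtr_gt0.
have t1 : t < 1 by rewrite -(@ltr_pXn2r _ 2) ?nnegrE ?(ltW t0)// expr1n sqr_sqrtr// ltW.
have [C tC] := IH t t0 t1; exists ((1 - t)^-1 * C) => k.
have -> : k.+1%:R ^+ m.+1 * q ^+ k = (k.+1%:R * t ^+ k) * (k.+1%:R ^+ m * t ^+ k).
  by rewrite -[q](sqr_sqrtr (ltW q0)) -/t exprAC expr2 exprS; ring.
have t0' := ltW t0.
apply: ler_pM => //; first by rewrite mulr_ge0// exprn_ge0.
  by rewrite mulr_ge0// exprn_ge0.
apply: le_trans (letter_sum_le t0 t1 k.+1).
rewrite mulr_natl -[X in _ *+ X]card_ord -sumr_const; apply: ler_sum => a _.
by rewrite ler_wiXn2l ?(ltW t1)// leq_ord.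
Qed.

(** The error of [lis_mean_le] for gaps of order [Num.sqrt n], the scale of the
    fluctuations. *)
Lemma gap_error_le (q d : R) M : 0 < q -> q < 1 -> 0 < d -> exists D : R,
  forall n, (0 < n)%N ->
    q ^+ Num.truncn (d * Num.sqrt n%:R) * n.+1%:R ^+ M <= D / n.+1%:R.
Proof.
move=> q0 q1 d0; have [C qC] := polynomial_geometric_bounded (2 * M.+1) q0 q1.
have d2 : 0 < (d ^+ 2) ^+ M.+1 by rewrite !exprn_gt0.
exists (2 ^+ M.+1 * (C / (d ^+ 2) ^+ M.+1)) => n n0.
set k := Num.truncn _; rewrite ler_pdivlMr// -mulrA -exprSr.
apply: (@le_trans _ _ (q ^+ k * (2 ^+ M.+1 * n%:R ^+ M.+1))).
  rewrite ler_wpM2l ?exprn_ge0 ?(ltW q0)// -exprMn lerXn2r ?nnegrE ?mulr_ge0//.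
  by rewrite -natrM ler_nat; lia.
rewrite mulrCA ler_wpM2l ?exprn_ge0// ler_pdivlMr// -mulrA -exprMn.
apply: le_trans (qC k); rewrite mulrC ler_wpM2r ?exprn_ge0 ?(ltW q0)//.
have d0' := ltW d0; rewrite exprM lerXn2r ?nnegrE ?mulr_ge0 ?exprn_ge0//.
rewrite mulrC -[X in _ * X]sqr_sqrtr ?ler0n// -exprMn lerXn2r ?nnegrE ?mulr_ge0//.
exact/ltW/truncnS_gt.
Qed.

End rates.

Section imaj_integral.
Context {R : realType}.
Variables (q : R) (q0 : 0 < q) (n : nat).

Lemma integral_imaj_prob (Y : 'S_n -> R) :
  (\int[imaj_prob q0 n]_s (Y s)%:E = (\sum_(s : 'S_n) imaj_pmf q s * Y s)%:E)%E.
Proof.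
have int1 (s : 'S_n) :
    (imaj_prob q0 n).-integrable [set: 'S_n] (fun t => (\1_[set s] t)%:E).
  exact: integrable_indic.
transitivity (\int[imaj_prob q0 n]_t (\sum_(s : 'S_n) (Y s)%:E * (\1_[set s] t)%:E))%E.
  apply: eq_integral => t _; rewrite (bigD1 t)//= indicE mem_set// mule1.
  rewrite big1 ?adde0// => s st; rewrite indicE memNset ?mule0//= => ts.
  by rewrite ts eqxx in st.
rewrite integral_sum//; last by move=> s; exact: integrableZl.
rewrite -sumEFin; apply: eq_bigr => s _.
rewrite integralZl// integral_indic// setIT EFinM muleC.
by congr (_ * _)%E; exact: imaj_prob_set1.
Qed.

Lemma imaj_prob_le (A : set 'S_n) (F : 'S_n -> R) : (forall s, 0 <= F s) ->
  (forall s, A s -> 1 <= F s) ->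
  (imaj_prob q0 n A <= (\sum_(s : 'S_n) imaj_pmf q s * F s)%:E)%E.
Proof.
move=> F0 AF; rewrite /imaj_prob -sumEFin; apply: lee_sum => s _.
rewrite [leRHS]EFinM lee_wpmul2l ?lee_fin ?imaj_pmf_ge0// indicE.
by have [/set_mem/AF|] := boolP (s \in A).
Qed.

End imaj_integral.

Section fluctuations.
Context {R : realType}.
Variable q : R.
Hypotheses (q0 : 0 < q) (q1 : q < 1).
Local Notation p := (1 - q).

Let p0 : 0 < p. Proof. by rewrite subr_gt0. Qed.
Let p1 : p < 1. Proof. by rewrite gtrBl. Qed.
Let v1 : p * (1 - p) <= 1. Proof. by move: p0 p1 => *; nra. Qed.

Lemma truncation_exists : exists M, q ^+ M <= q * (1 - q).
Proof.
have qq : 0 < q * (1 - q) by rewrite mulr_gt0.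
have : q ^+ N @[N --> \oo] --> 0 by apply: cvg_expr; rewrite gtr0_norm.
move=> /cvgrPdist_le/(_ _ qq) [M _ qM]; exists M.
by have := qM M (leqnn M); rewrite sub0r normrN ger0_norm// exprn_ge0// ltW.
Qed.

(** Chebyshev's inequality: apply [lis_mean_le] to the squared relative deviation.
    A gap of length at most [Num.sqrt n] changes the square of a deviation [a] to at most
    [2 * a ^+ 2 + 2 * n], of the order of the binomial variance. *)
Lemma lis_deviation_prob_le (e : R) : 0 < e -> exists D : R, forall n, (0 < n)%N ->
  (imaj_prob q0 n [set s : 'S_n | e < `|(lis s)%:R / (n%:R * p) - 1|]%R <=
    (D * n.+1%:R^-1)%:E)%E.
Proof.
move=> e0; have [M qM] := truncation_exists.
have [D0 errD] := gap_error_le M q0 q1 ltr01.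
exists ((8 + D0) / (p * e) ^+ 2) => n n0.
have n0' : 0 < n%:R :> R by rewrite ltr0n.
pose c := (n%:R * p * e) ^+ 2.
have c0 : 0 < c by rewrite exprn_gt0// !mulr_gt0.
pose k := Num.truncn (1 * Num.sqrt n%:R : R).
pose F (j : nat) : R := (j%:R - n%:R * p) ^+ 2 / c.
pose V (i : nat) : R := (2 * (i%:R - n%:R * p) ^+ 2 + 2 * n%:R) / c.
have F0 j : 0 <= F j by rewrite divr_ge0 ?sqr_ge0// ltW.
have k2 : k%:R ^+ 2 <= n%:R :> R.
  rewrite -[leRHS]sqr_sqrtr ?ler0n// lerXn2r ?nnegrE// -[leRHS]mul1r truncn_le.
  by rewrite mulr_ge0.
apply: (@le_trans _ _ (\sum_(s : 'S_n) imaj_pmf q s * F (lis s))%:E).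
  apply: imaj_prob_le => // s /= es; rewrite ler_pdivlMr// mul1r /c.
  rewrite -[leRHS](real_normK (num_real _)) lerXn2r ?nnegrE ?mulr_ge0 ?(ltW p0) ?(ltW e0)//.
  have -> : (lis s)%:R - n%:R * p = (n%:R * p) * ((lis s)%:R / (n%:R * p) - 1).
    by field; rewrite !gt_eqF.
  by rewrite normrM gtr0_norm ?mulr_gt0// ler_wpM2l ?mulr_ge0 ?(ltW p0)// ltW.
rewrite lee_fin.
(* Deviations never exceed n, whatever the gap. *)
have B0 : 0 <= n%:R ^+ 2 / c by rewrite divr_ge0 ?sqr_ge0// ltW.
have near_FV i j : (i <= j <= n)%N -> (j < i + k)%N -> F j <= V i.
  move=> /andP[ij jn] jik; rewrite /F /V ler_pM2r ?invr_gt0//.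
  have ji : (j%:R - i%:R) ^+ 2 <= n%:R :> R.
    apply: le_trans k2; rewrite -natrB// lerXn2r ?nnegrE// ler_nat; lia.
  set a := i%:R - n%:R * p.
  have -> : j%:R - n%:R * p = a + (j%:R - i%:R) by rewrite /a; ring.
  have := sqr_ge0 (a - (j%:R - i%:R)); set b := j%:R - i%:R in ji *; nra.
have far_FV i j : (i <= j <= n)%N -> F j <= V i + n%:R ^+ 2 / c.
  move=> /andP[ij jn]; rewrite /F /V -mulrDl ler_pM2r ?invr_gt0//.
  apply: ler_wpDl; first by apply: addr_ge0; apply: mulr_ge0 => //; exact: sqr_ge0.
  rewrite -[leLHS](real_normK (num_real _)) lerXn2r ?nnegrE//.
  have : j%:R <= n%:R :> R by rewrite ler_nat.
  have : 0 <= j%:R :> R by [].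
  move: (j%:R : R) n0' p0 p1 => x N0 P0 P1 x0 xn.
  rewrite ler_norml; apply/andP; split; nra.
apply: (le_trans (lis_mean_le q0 q1 qM B0 near_FV far_FV)).
rewrite (_ : V = (fun i => c^-1 * (2 * (i%:R - n%:R * p) ^+ 2 + 2 * n%:R))); last first.
  by apply/funext => i; rewrite mulrC.
rewrite binomial_meanZ binomial_meanD binomial_meanZ binomial_variance binomial_mean_cst.
have -> : (8 + D0) / (p * e) ^+ 2 / n.+1%:R =
    8 / (p * e) ^+ 2 / n.+1%:R + n%:R ^+ 2 / c * (D0 / n.+1%:R).
  by rewrite /c; field; rewrite !gt_eqF//= addr_gt0.
apply: lerD; last by rewrite -mulrA ler_wpM2l// errD.
have -> : c^-1 * (2 * (n%:R * (p * (1 - p))) + 2 * n%:R) =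
    2 * (p * (1 - p) + 1) / n%:R / (p * e) ^+ 2.
  by rewrite /c; field; rewrite !gt_eqF.
rewrite -[leRHS]mulrA [X in _ <= _ * X]mulrC mulrA ler_wpM2r ?invr_ge0 ?sqr_ge0//.
apply: (@le_trans _ _ (4 / n%:R)).
  by rewrite ler_wpM2r ?invr_ge0//; move: v1 => ?; lra.
rewrite ler_pdivrMr// mulrAC ler_pdivlMr// -!natrM ler_nat; lia.
Qed.

(** Gaps shorter than [d * Num.sqrt n] move the standardized variable by less than [d],
    and longer gaps have negligible probability. *)
Lemma lis_mean_le_binomial (h : R -> R) : continuous h -> bounded_fun h ->
  forall e : R, 0 < e -> \forall n \near \oo,
    \sum_(s : 'S_n) imaj_pmf q s * h (standardized p n (lis s)) <=
    binomial_mean p n (fun j => h (standardized p n j)) + e.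
Proof.
move=> ch bh e e0; have [M qM] := truncation_exists.
have [H hH] : exists H, forall x, `|h x| <= H.
  have [H [_ hH]] := bh; exists (H + 1) => x; by apply: hH => //; rewrite ltrDl.
have H0 : 0 <= H by apply: le_trans (hH 0).
have e4 : 0 < e / 4 by rewrite divr_gt0.
have [d d0 osc] := oscillation_le ch hH e4.
have [D0 errD] := gap_error_le M q0 q1 d0.
near=> n; have n0 : (0 < n)%N by near: n; exact: nbhs_infty_gt.
pose r : R := Num.sqrt n%:R; have r0 : 0 < r by rewrite sqrtr_gt0 ltr0n.
have r2 : r ^+ 2 = n%:R by rewrite sqr_sqrtr.
pose X := standardized p n; pose k := Num.truncn (d * r).
pose V i := h (X i) + e / 4 * (1 + X i ^+ 2).
have V_ge i : h (X i) <= V i by rewrite lerDl mulr_ge0 ?(ltW e4)// addr_ge0// sqr_ge0.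
have B0 : 0 <= H + H by rewrite addr_ge0.
have near_hV i j : (i <= j <= n)%N -> (j < i + k)%N -> h (X j) <= V i.
  move=> /andP[ij jn] jik; rewrite /V -lerBlDl.
  apply: le_trans (ler_norm _) _; apply: osc.
  have -> : X j - X i = (j - i)%:R / r.
    by rewrite /X /standardized -/r natrB//; ring.
  rewrite ger0_norm ?divr_ge0 ?(ltW r0)// ler_pdivrMr//.
  apply: (@le_trans _ _ k%:R); first by rewrite ler_nat; lia.
  by rewrite truncn_le mulr_ge0 ?ltW.
have far_hV i j : (i <= j <= n)%N -> h (X j) <= V i + (H + H).
  move=> _; rewrite -lerBlDr; apply: le_trans (V_ge i).
  have := hH (X j); have := hH (X i); rewrite !ler_norml => /andP[+ _] /andP[_ +]; lra.
apply: (le_trans (lis_mean_le (F := fun j => h (X j)) q0 q1 qM B0 near_hV far_hV)).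
rewrite binomial_meanD -!addrA lerD2l binomial_meanZ binomial_meanD binomial_mean_cst.
have -> : binomial_mean p n (fun i => X i ^+ 2) = p * (1 - p).
  rewrite (_ : (fun i => _) = (fun i => n%:R^-1 * (i%:R - n%:R * p) ^+ 2)); last first.
    by apply/funext => i; rewrite /X /standardized expr_div_n -/r r2 mulrC.
  by rewrite binomial_meanZ binomial_variance mulKf// pnatr_eq0 -lt0n.
apply: (@le_trans _ _ (e / 2 + e / 2)); last by rewrite -splitr.
apply: lerD.
  have -> : e / 2 = e / 4 * (1 + 1) by field.
  by rewrite ler_wpM2l ?(ltW e4)// lerD2l.
rewrite -mulrA; apply: (@le_trans _ _ ((H + H) * (D0 / n.+1%:R))).
  by rewrite ler_wpM2l// errD.
rewrite mulrA ler_pdivrMr// -ler_pdivrMl ?divr_gt0//.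
rewrite (@le_trans _ _ n%:R)// ?ler_nat//; near: n; exact: nbhs_infty_ger.
Unshelve. all: by end_near. Qed.

Lemma lis_clt (h : R -> R) (m : R) : continuous h -> bounded_fun h ->
  m%:E = (\int[normal_prob 0 (Num.sqrt (q * (1 - q)))]_y (h y)%:E)%E ->
  \sum_(s : 'S_n) imaj_pmf q s * h (standardized p n (lis s)) @[n --> \oo] --> m.
Proof.
move=> ch bh mE.
have vE : q * (1 - q) = p * (1 - p) by ring.
have cvgT := binomial_clt p0 p1 ch bh; rewrite -vE in cvgT.
have cNh : continuous (fun x => - h x) by move=> x; apply: cvgN; exact: ch.
have bNh : bounded_fun (fun x => - h x).
  have [H [Hr hH]] := bh; exists H; split => // y Hy x xT.
  by rewrite /= normrN; exact: hH.
apply/cvgrPdist_le => e e0; have e2 : 0 < e / 2 by rewrite divr_gt0.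
have /cvgrPdist_le/(_ _ e2) T_le := cvgT m mE.
near=> n.
(* The bound for - h is the lower bound for h. *)
have up : \sum_(s : 'S_n) imaj_pmf q s * h (standardized p n (lis s)) <=
    binomial_mean p n (fun j => h (standardized p n j)) + e / 2.
  by near: n; exact: lis_mean_le_binomial.
have : \sum_(s : 'S_n) imaj_pmf q s * (- h (standardized p n (lis s))) <=
    binomial_mean p n (fun j => - h (standardized p n j)) + e / 2.
  by near: n; exact: (lis_mean_le_binomial cNh bNh).
have -> : binomial_mean p n (fun j => - h (standardized p n j)) =
    - binomial_mean p n (fun j => h (standardized p n j)).
  by rewrite -[RHS]mulN1r -binomial_meanZ; congr binomial_mean; apply/funext => j; rewrite mulN1r.
under eq_bigr do rewrite mulrN; rewrite sumrN => low.
have : `|m - binomial_mean p n (fun j => h (standardized p n j))| <= e / 2 by near: n.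
move: up low; rewrite !ler_norml.
move: (\sum_(s : 'S_n) _) (binomial_mean _ _ _) => S T up low /andP[mT Tm].
apply/andP; split; lra.
Unshelve. all: by end_near. Qed.

End fluctuations.

Theorem theorem5 (R : realType) (q : R) (q0 : 0 < q) (q1 : q < 1) :
  cvg_in_prob_to_cst (P := imaj_prob q0)
    (fun n => perm_rv (fun s : 'S_n => (lis s)%:R / (n%:R * (1 - q)))) 1
  /\
  cvg_in_law (P := imaj_prob q0)
    (fun n => perm_rv (fun s : 'S_n =>
       ((lis s)%:R - n%:R * (1 - q)) / Num.sqrt n%:R))
    (normal_prob 0 (Num.sqrt (q * (1 - q)))).
Proof.
split=> [e e0|h ch bh].
  have [D PD] := lis_deviation_prob_le q0 q1 e0.
  apply: (@squeeze_cvge _ _ _ _ (cst 0%E) _ (fun n => (D * n.+1%:R^-1)%:E)).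
  - near=> n; rewrite measure_ge0/= PD//; near: n; exact: nbhs_infty_gt.
  - exact: cvg_cst.
  - have cvgD : D * harmonic n @[n --> \oo] --> D * 0.
      by apply: cvgM; [exact: cvg_cst|exact: cvg_harmonic].
    by apply: cvg_EFin; [exact: nearW|rewrite mulr0 in cvgD].
set I := (\int[_]_y _)%E.
have mE : (fine I)%:E = I.
  rewrite fineK//; apply: integrable_fin_num => //.
  apply: measurable_bounded_integrable => //.
    exact: (le_lt_trans (probability_le1 _ _) (ltry _)).
  exact: continuous_measurable_fun.
rewrite -mE; have cvgS := lis_clt q0 q1 ch bh mE.
rewrite (_ : (fun n => _) = (fun n =>
    (\sum_(s : 'S_n) imaj_pmf q s * h (standardized (1 - q) n (lis s)))%:E)).
  by apply: cvg_EFin => //; exact: nearW.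
by apply/funext => n; rewrite unlock integral_imaj_prob.
Unshelve. all: by end_near. Qed.
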